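(* The graph algebra $\mathcal A$, as an $\mathfrak{sl}_2$-module, decomposes into a direct sum of irreducible modules $$\mathcal A\cong\bigoplus_{k=0}^{\lfloor m/2\rfloor}\mu_k\,V_{m-2k},$$ where $$\mu_k=\dim P_k=\binom mk-\binom m{k-1},\qquad 0\le k\le\left\lfloor\frac m2\right\rfloor,\qquad \binom m{-1}=0,$$ and $\mu_kV_{m-2k}$ denotes the direct sum of $\mu_k$ copies of $V_{m-2k}$.
   Context: Let $m=\binom n2$, where $n$ is the number of vertices, and $[m]=\{1,\dots,m\}$. The graph algebra is $\mathcal A=\mathbb C[x_1,\dots,x_m]/(x_1^2-x_1,\dots,x_m^2-x_m)$, with vector space basis $\boldsymbol{x}_S=\prod_{e\in S}x_e$, $S\subseteq[m]$. For $0\le k\le m$, $A_k=\operatorname{span}_{\mathbb C}\{\boldsymbol{x}_S:|S|=k\}$, and $A_{-1}=0$. Linear operators on $\mathcal A$ are defined by $D_+(\boldsymbol{x}_S)=\sum_{e\in[m]\setminus S}\boldsymbol{x}_{S\cup\{e\}}$, $D_-(\boldsymbol{x}_S)=\sum_{e\in S}\boldsymbol{x}_{S\setminus\{e\}}$, $D_0(\boldsymbol{x}_S)=-(m-2|S|)\boldsymbol{x}_S$ (empty sums are zero). They make $\mathcal A$ an $\mathfrak{sl}_2$-module via $e_\pm\mapsto D_\pm$, $h\mapsto D_0$, where $\mathfrak{sl}_2=\mathfrak{sl}_2(\mathbb C)$ has basis $e_+,e_-,h$ with $[h,e_\pm]=\pm2e_\pm$, $[e_+,e_-]=h$. The primitive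 spaces are $P_k=\ker(D_-:A_k\to A_{k-1})$. $V_d$ denotes the irreducible $\mathfrak{sl}_2$-module of dimension $d+1$, with basis $v_0,\dots,v_d$ and action $e_+v_i=(d-i)v_{i+1}$, $hv_i=(2i-d)v_i$, $e_-v_i=iv_{i-1}$ (with $v_{-1}=v_{d+1}=0$). *)

(* Defs.v *)
From HB Require Import structures.
From mathcomp Require Import all_boot all_order all_algebra.
From mathcomp Require Import ring_quotient ring.
From mathcomp Require Import boolp reals complex mpoly.

Set Implicit Arguments.
Unset Strict Implicit.
Unset Printing Implicit Defensive.

Import GRing.Theory.
Local Open Scope ring_scope.
Local Open Scope quotient_scope.

Section Sl2.
Variable F : fieldType.

Definition traceless : {vspace 'M[F]_2} :=
  lker (linfun (@mxtrace F 2 : 'M[F]_2 -> F^o)).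

Lemma mem_traceless (M : 'M[F]_2) : (M \in traceless) = (\tr M == 0).
Proof. by rewrite memv_ker lfunE. Qed.

(* sl_2 is the Lie algebra of traceless 2 x 2 matrices. *)
Definition sl2 : vectType F := subvs_of traceless.

Definition sl2_bracket (x y : sl2) : sl2 :=
  vsproj traceless (vsval x *m vsval y - vsval y *m vsval x).

Lemma sl2_bracketE (x y : sl2) :
  vsval (sl2_bracket x y) = vsval x *m vsval y - vsval y *m vsval x.
Proof. by rewrite vsprojK // mem_traceless raddfB /= mxtrace_mulC subrr. Qed.

Definition sl2_ep : sl2 := vsproj traceless (delta_mx 0 1).
Definition sl2_em : sl2 := vsproj traceless (delta_mx 1 0).
Definition sl2_h : sl2 := vsproj traceless (delta_mx 0 0 - delta_mx 1 1).

Lemma mx2P (A B : 'M[F]_2) :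
  A 0 0 = B 0 0 -> A 0 1 = B 0 1 -> A 1 0 = B 1 0 -> A 1 1 = B 1 1 -> A = B.
Proof.
move=> h00 h01 h10 h11; apply/matrixP.
have ord2 (i : 'I_2) : i = 0 \/ i = 1.
  by case: i => [[|[|//]] hi]; [left|right]; apply/val_inj.
by move=> i j; case: (ord2 i) => ->; case: (ord2 j) => ->.
Qed.

Lemma mulmx2E (A B : 'M[F]_2) i j :
  (A *m B) i j = A i 0 * B 0 j + A i 1 * B 1 j.
Proof.
rewrite mxE !big_ord_recl big_ord0 addr0.
by congr (_ + A i _ * B _ j); apply/val_inj.
Qed.

Lemma mxcomm2E (A B : 'M[F]_2) i j :
  (A *m B - B *m A) i j =
  A i 0 * B 0 j + A i 1 * B 1 j - (B i 0 * A 0 j + B i 1 * A 1 j).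
Proof. by rewrite -!mulmx2E mxE [X in _ + X]mxE. Qed.

Lemma mxtrace2E (A : 'M[F]_2) : \tr A = A 0 0 + A 1 1.
Proof.
rewrite /mxtrace !big_ord_recl big_ord0 addr0.
by congr (_ + A _ _); apply/val_inj.
Qed.

Lemma sl2_epE : vsval sl2_ep = delta_mx 0 1.
Proof. by rewrite vsprojK // mem_traceless mxtrace2E !mxE /= addr0. Qed.

Lemma sl2_emE : vsval sl2_em = delta_mx 1 0.
Proof. by rewrite vsprojK // mem_traceless mxtrace2E !mxE /= addr0. Qed.

Lemma sl2_hE : vsval sl2_h = delta_mx 0 0 - delta_mx 1 1.
Proof.
by rewrite vsprojK // mem_traceless mxtrace2E !mxE /= subr0 sub0r subrr.
Qed.

Lemma sl2_11 (x : sl2) : vsval x 1 1 = - vsval x 0 0.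
Proof.
have := subvsP x; rewrite mem_traceless mxtrace2E addrC addr_eq0.
by move/eqP.
Qed.

Lemma sl2_span (x : sl2) :
  x = vsval x 0 1 *: sl2_ep + vsval x 1 0 *: sl2_em + vsval x 0 0 *: sl2_h.
Proof.
apply: val_inj; rewrite !linearD !linearZ /= sl2_epE sl2_emE sl2_hE.
by apply: mx2P; rewrite !mxE /= ?sl2_11; ring.
Qed.

Lemma sl2_bracket_h_ep : sl2_bracket sl2_h sl2_ep = 2%:R *: sl2_ep.
Proof.
apply: val_inj; rewrite linearZ /= sl2_bracketE sl2_epE sl2_hE.
by apply: mx2P; rewrite mxcomm2E !mxE /=; ring.
Qed.

Lemma sl2_bracket_h_em : sl2_bracket sl2_h sl2_em = - (2%:R *: sl2_em).
Proof.
rewrite -scaleNr; apply: val_inj.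
rewrite linearZ /= sl2_bracketE sl2_emE sl2_hE.
by apply: mx2P; rewrite mxcomm2E !mxE /=; ring.
Qed.

Lemma sl2_bracket_ep_em : sl2_bracket sl2_ep sl2_em = sl2_h.
Proof.
apply: val_inj; rewrite /= sl2_bracketE sl2_epE sl2_emE sl2_hE.
by apply: mx2P; rewrite mxcomm2E !mxE /=; ring.
Qed.

Record sl2_module := Sl2Module {
  sl2_sort :> lmodType F;
  sl2_act : sl2 -> sl2_sort -> sl2_sort;
  sl2_act_linearl : forall a x y v,
    sl2_act (a *: x + y) v = a *: sl2_act x v + sl2_act y v;
  sl2_act_linearr : forall x a u v,
    sl2_act x (a *: u + v) = a *: sl2_act x u + sl2_act x v;
  sl2_act_bracket : forall x y v,
    sl2_act (sl2_bracket x y) v =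
    sl2_act x (sl2_act y v) - sl2_act y (sl2_act x v)
}.

Definition sl2_submodule (M : sl2_module) (W : M -> Prop) : Prop :=
  [/\ W 0, forall a u v, W u -> W v -> W (a *: u + v)
    & forall x v, W v -> W (sl2_act x v)].

Definition sl2_irreducible (M : sl2_module) : Prop :=
  (exists v : M, v <> 0) /\
  (forall W : M -> Prop, sl2_submodule W ->
     (forall v, W v -> v = 0) \/ (forall v, W v)).

Definition sl2_isomorphic (M N : sl2_module) : Prop :=
  exists f : {linear M -> N},
    bijective f /\ forall x v, f (sl2_act x v) = sl2_act x (f v).

Lemma scalar_ext (V : vectType F) (u v : V) :
  (forall f : V -> F, {morph f : x y / x + y} -> {morph f : x / - x} ->
     (forall a x, f (a *: x) = a * f x) -> f u = f v) -> u = v.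
Proof.
move=> uv; rewrite (coord_vbasis (memvf u)) (coord_vbasis (memvf v)).
apply: eq_bigr => i _; congr (_ *: _); apply: uv.
- exact: linearD.
- exact: linearN.
- by move=> a x; rewrite linearZ.
Qed.

(* The module on which e_+, e_-, h act by E, G, H: a traceless matrix x is     *)
(* x_01 e_+ + x_10 e_- + x_00 h.                                              *)
Section Triple.
Variables (V : vectType F) (E G H : 'End(V)).

Definition triple_act (x : sl2) (v : V) : V :=
  vsval x 0 1 *: E v + vsval x 1 0 *: G v + vsval x 0 0 *: H v.

Hypothesis HE : forall v, H (E v) - E (H v) = 2%:R *: E v.
Hypothesis HG : forall v, H (G v) - G (H v) = - (2%:R *: G v).
Hypothesis EG : forall v, E (G v) - G (E v) = H v.

Lemma triple_act_linearl a x y v :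
  triple_act (a *: x + y) v = a *: triple_act x v + triple_act y v.
Proof.
rewrite /triple_act; apply: scalar_ext => f fD fN fZ.
by rewrite !(linearD, linearZ) /= !mxE !(fD, fZ); ring.
Qed.

Lemma triple_act_linearr x a u v :
  triple_act x (a *: u + v) = a *: triple_act x u + triple_act x v.
Proof.
rewrite /triple_act; apply: scalar_ext => f fD fN fZ.
by rewrite !(linearD, linearZ) /= !(fD, fZ); ring.
Qed.

Lemma triple_act_bracket x y v :
  triple_act (sl2_bracket x y) v =
  triple_act x (triple_act y v) - triple_act y (triple_act x v).
Proof.
have HE' w : H (E w) = E (H w) + 2%:R *: E w by rewrite -HE addrC subrK.
have HG' w : H (G w) = G (H w) - 2%:R *: G w by rewrite -HG addrC subrK.
have EG' w : E (G w) = G (E w) + H w by rewrite -EG addrC subrK.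
have lin3 (L : 'End(V)) a b c u1 u2 u3 :
    L (a *: u1 + b *: u2 + c *: u3) = a *: L u1 + b *: L u2 + c *: L u3.
  by rewrite 2!linearD 3!linearZ.
rewrite /triple_act sl2_bracketE !mxcomm2E !sl2_11 !lin3 !HE' !HG' !EG'.
rewrite !(scalerDr, scalerN, scalerA); apply: scalar_ext => f fD fN fZ.
by rewrite !(fD, fN, fZ); ring.
Qed.

Lemma triple_act_ep v : triple_act sl2_ep v = E v.
Proof. by rewrite /triple_act sl2_epE !mxE /= scale1r !scale0r !addr0. Qed.

Lemma triple_act_em v : triple_act sl2_em v = G v.
Proof. by rewrite /triple_act sl2_emE !mxE /= scale1r !scale0r addr0 add0r. Qed.

Lemma triple_act_h v : triple_act sl2_h v = H v.
Proof.
by rewrite /triple_act sl2_hE !mxE /= !subr0 scale1r !scale0r !add0r.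
Qed.

Definition triple_module : sl2_module :=
  Sl2Module triple_act_linearl triple_act_linearr triple_act_bracket.
End Triple.
End Sl2.

Section GraphAlgebra.
Variables (F : fieldType) (m : nat).

(* Sums of multiples of the generators x_i ^ 2 - x_i; asbool makes membership *)
(* the boolean predicate that {ideal_quot _} expects.                         *)
Definition graph_ideal : {pred {mpoly F[m]}} := fun p =>
  `[< exists q : 'I_m -> {mpoly F[m]}, p = \sum_i q i * ('X_i ^+ 2 - 'X_i) >].

Definition point (T : {set 'I_m}) : 'I_m -> F := fun i => (i \in T)%:R.

Lemma graph_ideal_point p T : p \in graph_ideal -> p.@[point T] = 0.
Proof.
move=> /asboolP[q ->]; rewrite raddf_sum /= big1 // => i _.
rewrite mevalM mevalB expr2 mevalM mevalXU /point.
by case: (_ \in _); rewrite ?mulr1 ?mulr0 subrr mulr0.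
Qed.

Lemma graph_ideal_closed : idealr_closed graph_ideal.
Proof.
split.
- apply/asboolP; exists (fun=> 0); rewrite big1 // => i _.
  by rewrite mul0r.
- apply/negP => /(graph_ideal_point set0) /eqP.
  by rewrite meval1 oner_eq0.
- move=> a u v /asboolP[p ->] /asboolP[q ->]; apply/asboolP.
  exists (fun i => a * p i + q i); rewrite mulr_sumr -big_split /=.
  by apply: eq_bigr => i _; rewrite mulrDl mulrA.
Qed.

HB.instance Definition _ :=
  isIdealr.Build {mpoly F[m]} graph_ideal graph_ideal_closed.

Definition graph_algebra : Type := {ideal_quot graph_ideal}.

HB.instance Definition _ := GRing.ComNzRing.on graph_algebra.

Definition gclass : {mpoly F[m]} -> graph_algebra := \pi_{ideal_quot graph_ideal}.

Lemma gclass_zmod : zmod_morphism gclass.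
Proof. exact: raddfB. Qed.
Lemma gclass_monoid : monoid_morphism gclass.
Proof. by split; [exact: rmorph1 | exact: rmorphM]. Qed.
HB.instance Definition _ :=
  GRing.isZmodMorphism.Build {mpoly F[m]} graph_algebra gclass gclass_zmod.
HB.instance Definition _ :=
  GRing.isMonoidMorphism.Build {mpoly F[m]} graph_algebra gclass gclass_monoid.

Lemma gclass_eq p q : gclass p = gclass q <-> p - q \in graph_ideal.
Proof.
by rewrite Quotient.idealrBE; split => [/eqP|/eqP].
Qed.

Lemma gclassP (a : graph_algebra) : {p | gclass p = a}.
Proof. by exists (repr a); rewrite /gclass reprK. Qed.

Definition gscale (c : F) (a : graph_algebra) : graph_algebra :=
  gclass c%:MP * a.

Lemma gscaleA c d a : gscale c (gscale d a) = gscale (c * d) a.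
Proof. by rewrite /gscale mulrA mpolyCM rmorphM. Qed.
Lemma gscale1 : left_id 1 gscale.
Proof. by move=> a; rewrite /gscale mpolyC1 rmorph1 mul1r. Qed.
Lemma gscaleDr : right_distributive gscale +%R.
Proof. by move=> c a b; rewrite /gscale mulrDr. Qed.
Lemma gscaleDl a : {morph gscale^~ a : c d / c + d}.
Proof. by move=> c d; rewrite /gscale mpolyCD rmorphD mulrDl. Qed.

HB.instance Definition _ :=
  GRing.Zmodule_isLmodule.Build F graph_algebra gscaleA gscale1 gscaleDr gscaleDl.

Lemma gscaleAl (c : F) (a b : graph_algebra) : c *: (a * b) = (c *: a) * b.
Proof. exact: mulrA. Qed.
HB.instance Definition _ :=
  GRing.Lmodule_isLalgebra.Build F graph_algebra gscaleAl.
HB.instance Definition _ :=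
  GRing.Lalgebra_isComAlgebra.Build F graph_algebra.

Lemma gclassZ c p : gclass (c *: p) = c *: gclass p.
Proof. by rewrite -mul_mpolyC rmorphM. Qed.

(* The class of x_e *)
Definition gvar (e : 'I_m) : graph_algebra := gclass 'X_e.

(* The basis vector x_S *)
Definition gmon (S : {set 'I_m}) : graph_algebra := \prod_(e in S) gvar e.

Lemma gvar_idem e : gvar e ^+ 2 = gvar e.
Proof.
rewrite /gvar -rmorphXn; apply/gclass_eq/asboolP.
exists (fun i => (i == e)%:R); rewrite (bigD1 e) //= eqxx mul1r big1 ?addr0 //.
by move=> i /negPf ->; rewrite mul0r.
Qed.

Lemma gvar_exp e k : gvar e ^+ k = if k == 0%N then 1 else gvar e.
Proof.
case: k => [|k]; first by rewrite expr0.
elim: k => [|k IHk]; first by rewrite expr1.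
by rewrite exprS IHk -expr2 gvar_idem.
Qed.

Lemma gclassX (u : 'X_{1..m}) : gclass 'X_[u] = gmon [set i | u i != 0%N].
Proof.
rewrite mpolyXE_id rmorph_prod [RHS]big_mkcond; apply: eq_bigr => i _.
by rewrite rmorphXn /= gvar_exp inE; case: eqP.
Qed.

Definition geval (T : {set 'I_m}) (a : graph_algebra) : F :=
  (sval (gclassP a)).@[point T].

Lemma geval_class T p : geval T (gclass p) = p.@[point T].
Proof.
rewrite /geval; case: gclassP => q /= /gclass_eq/graph_ideal_point h.
by apply/eqP; rewrite -subr_eq0 -mevalB h.
Qed.

Lemma geval_linear T : scalar (geval T).
Proof.
move=> c a b; have [p <-] := gclassP a; have [q <-] := gclassP b.
by rewrite -gclassZ -rmorphD !geval_class mevalD mevalZ.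
Qed.
HB.instance Definition _ T :=
  GRing.isLinear.Build F graph_algebra F _ (geval T) (geval_linear T).

Lemma geval_gmon T S : geval T (gmon S) = (S \subset T)%:R.
Proof.
rewrite /gmon /gvar -rmorph_prod geval_class rmorph_prod.
under eq_bigr do rewrite /= mevalXU /point.
have [/subsetP sST | /subsetPn[e eS eT]] := boolP (S \subset T).
  by rewrite big1 // => e /sST ->.
by rewrite (bigD1 e) //= (negPf eT) mul0r.
Qed.

Notation N := #|{: {set 'I_m}}|.

Definition gcomb (c : 'rV[F]_N) : graph_algebra :=
  \sum_(S : {set 'I_m}) c 0 (enum_rank S) *: gmon S.

Lemma gcomb_linear : linear gcomb.
Proof.
move=> a c d; rewrite /gcomb scaler_sumr -big_split /=; apply: eq_bigr => S _.
by rewrite !mxE scalerDl scalerA.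
Qed.
HB.instance Definition _ :=
  GRing.isLinear.Build F 'rV[F]_N graph_algebra _ gcomb gcomb_linear.

Lemma gcomb_inj : injective gcomb.
Proof.
apply: raddf_inj => c c0.
suff cS k (S : {set 'I_m}) : (#|S| < k)%N -> c 0 (enum_rank S) = 0.
  by apply/rowP => i; rewrite mxE -(enum_valK i) (cS #|enum_val i|.+1).
elim: k S => // k IHk S Sk.
have := congr1 (geval S) c0; rewrite linear0 linear_sum /= (bigD1 S) //=.
rewrite linearZ /= geval_gmon subxx mulr1 big1 ?addr0 // => T TS.
rewrite linearZ /= geval_gmon; case: (boolP (T \subset S)) => sTS; last by rewrite mulr0.
rewrite IHk ?mul0r // -ltnS (leq_trans _ Sk) // ltnS proper_card //.
by rewrite properEneq TS.
Qed.

Lemma gcomb_surj a : exists c, gcomb c == a.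
Proof.
have [p <-] := gclassP a; rewrite (mpolyE p) raddf_sum /=.
elim/big_rec: _ => [|u x _ [c /eqP cx]]; first by exists 0; rewrite linear0.
exists (p@_u *: delta_mx 0 (enum_rank [set i | u i != 0%N]) + c).
rewrite linearP /= cx gclassZ gclassX; apply/eqP; congr (_ *: _ + _).
rewrite /gcomb (bigD1 [set i | u i != 0%N]) //= mxE !eqxx scale1r big1 ?addr0 //.
move=> S neS; rewrite mxE /= (inj_eq enum_rank_inj) (negPf neS).
by rewrite scale0r.
Qed.

Definition gcoord a : 'rV[F]_N := xchoose (gcomb_surj a).
Lemma gcoordK : cancel gcoord gcomb.
Proof. by move=> a; apply/eqP/(xchooseP (gcomb_surj a)). Qed.
Lemma gcombK : cancel gcomb gcoord.
Proof. by move=> c; apply: gcomb_inj; rewrite gcoordK. Qed.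

Lemma gcoord_linear : linear gcoord.
Proof. exact: can2_linear gcombK gcoordK. Qed.

Lemma graph_algebra_findim : Vector.axiom N graph_algebra.
Proof.
by exists gcoord; [exact: gcoord_linear | exists gcomb; [exact: gcoordK | exact: gcombK]].
Qed.
HB.instance Definition _ :=
  Lmodule_hasFinDim.Build F graph_algebra graph_algebra_findim.

HB.instance Definition _ :=
  GRing.isLinear.Build F graph_algebra 'rV[F]_N _ gcoord gcoord_linear.

Lemma gcoord_gmon S T : gcoord (gmon S) 0 (enum_rank T) = (T == S)%:R.
Proof.
suff -> : gmon S = gcomb (delta_mx 0 (enum_rank S)).
  by rewrite gcombK mxE eqxx (inj_eq enum_rank_inj).
rewrite /gcomb (bigD1 S) //= mxE !eqxx scale1r big1 ?addr0 // => U US.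
by rewrite mxE (inj_eq enum_rank_inj) (negPf US) andbF scale0r.
Qed.

Definition gbasis : N.-tuple graph_algebra := [tuple gmon (enum_val i) | i < N].

Lemma gbasis_basis : basis_of fullv gbasis.
Proof.
rewrite basisEfree subvf size_tuple dimvf leqnn !andbT.
apply/(@freeP _ _ _ gbasis) => c c0 i.
have gE (j : 'I_N) : gcoord gbasis`_j 0 i = (i == j)%:R.
  rewrite -tnth_nth tnth_mktuple -{1}(enum_valK i) gcoord_gmon.
  by rewrite (inj_eq enum_val_inj).
have -> : c i = gcoord (\sum_(j < N) c j *: gbasis`_j) 0 i.
  rewrite linear_sum summxE.
  under eq_bigr => j _ do rewrite linearZ mxE gE.
  rewrite (bigD1 i) //= eqxx mulr1 big1 ?addr0 // => j ji.
  by rewrite eq_sym (negPf ji) mulr0.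
by rewrite c0 linear0 mxE.
Qed.

(* The linear map with prescribed values on the basis (gmon S)_S *)
Definition gext (V : vectType F) (v : {set 'I_m} -> V) : 'Hom(graph_algebra, V) :=
  linfun (fun a => \sum_i coord gbasis i a *: v (enum_val i)).

Lemma gext_gmon (V : vectType F) (v : {set 'I_m} -> V) S : gext v (gmon S) = v S.
Proof.
pose f a : V := \sum_i coord gbasis i a *: v (enum_val i).
have f_lin : linear f.
  move=> c a b; rewrite /f scaler_sumr -big_split /=; apply: eq_bigr => i _.
  by rewrite linearP scalerDl scalerA.
pose fM := GRing.isLinear.Build F graph_algebra V _ f f_lin.
pose fL : {linear graph_algebra -> V} := HB.pack f fM.
rewrite (lfunE fL) /= /f.
have -> : gmon S = gbasis`_(enum_rank S).
  by rewrite -tnth_nth tnth_mktuple enum_rankK.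
have fr := basis_free gbasis_basis.
rewrite (bigD1 (enum_rank S)) //= coord_free // eqxx scale1r enum_rankK.
by rewrite big1 ?addr0 // => i iS; rewrite coord_free // eq_sym (negPf iS) scale0r.
Qed.

Lemma gext_unique (V : vectType F) (f g : 'Hom(graph_algebra, V)) :
  (forall S, f (gmon S) = g (gmon S)) -> f = g.
Proof.
move=> fg; apply/lfunP => a; rewrite -(gcoordK a) /gcomb !linear_sum.
by apply: eq_bigr => S _; rewrite !linearZ /= fg.
Qed.

Definition D_plus : 'End(graph_algebra) :=
  gext (fun S => \sum_(e in ~: S) gmon (e |: S)).
Definition D_minus : 'End(graph_algebra) :=
  gext (fun S => \sum_(e in S) gmon (S :\ e)).
Definition D_zero : 'End(graph_algebra) :=
  gext (fun S => - ((m%:R - 2%:R * #|S|%:R) *: gmon S)).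

(* A_k *)
Definition graded_part (k : nat) : {vspace graph_algebra} :=
  <<[seq gmon T | T in [pred T : {set 'I_m} | #|T| == k]]>>%VS.

(* P_k; no case k = 0 is needed for A_{-1} = 0, since D_- vanishes on A_0 *)
Definition primitive (k : nat) : {vspace graph_algebra} :=
  (graded_part k :&: lker D_minus)%VS.

End GraphAlgebra.

Section GraphModule.
Variables (F : fieldType) (m : nat).

Lemma D_plus_gmon (S : {set 'I_m}) :
  D_plus F m (gmon F S) = \sum_(e in ~: S) gmon F (e |: S).
Proof. exact: gext_gmon. Qed.
Lemma D_minus_gmon (S : {set 'I_m}) :
  D_minus F m (gmon F S) = \sum_(e in S) gmon F (S :\ e).
Proof. exact: gext_gmon. Qed.
Lemma D_zero_gmon (S : {set 'I_m}) :
  D_zero F m (gmon F S) = - ((m%:R - 2%:R * #|S|%:R) *: gmon F S).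
Proof. exact: gext_gmon. Qed.

Lemma D_zero_plus a :
  D_zero F m (D_plus F m a) - D_plus F m (D_zero F m a) = 2%:R *: D_plus F m a.
Proof.
rewrite -[RHS]scale_lfunE; suff -> : 2%:R *: D_plus F m =
    (D_zero F m \o D_plus F m)%VF - (D_plus F m \o D_zero F m)%VF.
  by rewrite add_lfunE opp_lfunE !comp_lfunE.
apply: gext_unique => S; rewrite scale_lfunE add_lfunE opp_lfunE !comp_lfunE.
rewrite D_zero_gmon [fun_of_lfun _ (- _)]linearN /=.
rewrite [D_plus F m (_ *: _)]linearZ /= D_plus_gmon opprK.
rewrite [D_zero F m _]linear_sum /= !scaler_sumr -big_split /=.
apply: eq_bigr => e; rewrite inE => eS /=.
rewrite D_zero_gmon cardsU1 eS natrD /= -scaleNr -scalerDl.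
by congr (_ *: _); ring.
Qed.

Lemma D_zero_minus a :
  D_zero F m (D_minus F m a) - D_minus F m (D_zero F m a)
    = - (2%:R *: D_minus F m a).
Proof.
suff -> : D_minus F m (D_zero F m a) =
    (D_zero F m \o D_minus F m + 2%:R *: D_minus F m)%VF a.
  by rewrite add_lfunE comp_lfunE scale_lfunE opprD addrA subrr add0r.
rewrite -comp_lfunE; congr (fun_of_lfun _ a).
apply: gext_unique => S; rewrite add_lfunE scale_lfunE !comp_lfunE.
rewrite D_zero_gmon [fun_of_lfun _ (- _)]linearN /=.
rewrite [D_minus F m (_ *: _)]linearZ /= D_minus_gmon -scaleNr.
rewrite [D_zero F m _]linear_sum /= !scaler_sumr -big_split /=.
apply: eq_bigr => e eS /=.
rewrite D_zero_gmon (cardsD1 e S) eS natrD /= -scaleNr -scalerDl.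
by congr (_ *: _); ring.
Qed.

Lemma D_plus_minus a :
  D_plus F m (D_minus F m a) - D_minus F m (D_plus F m a) = D_zero F m a.
Proof.
suff -> : D_zero F m =
    (D_plus F m \o D_minus F m)%VF - (D_minus F m \o D_plus F m)%VF.
  by rewrite add_lfunE opp_lfunE !comp_lfunE.
apply: gext_unique => S; rewrite add_lfunE opp_lfunE !comp_lfunE.
rewrite D_zero_gmon D_plus_gmon D_minus_gmon.
rewrite [D_plus F m _]linear_sum [D_minus F m _]linear_sum /=.
pose W := \sum_(e in S) \sum_(f in ~: S) gmon F (f |: (S :\ e)).
have -> : \sum_(e in S) D_plus F m (gmon F (S :\ e)) = #|S|%:R *: gmon F S + W.
  rewrite scaler_nat -sumr_const -big_split; apply: eq_bigr => e eS /=.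
  rewrite D_plus_gmon; have -> : ~: (S :\ e) = e |: ~: S.
    by apply/setP => f; rewrite !inE negb_and negbK.
  by rewrite big_setU1 ?inE ?eS //= setD1K.
have -> : \sum_(f in ~: S) D_minus F m (gmon F (f |: S)) =
          #|~: S|%:R *: gmon F S + W.
  rewrite scaler_nat -sumr_const /W exchange_big -big_split /=.
  apply: eq_bigr => f; rewrite inE => fS; rewrite D_minus_gmon big_setU1 //=.
  rewrite setU1K //; congr (_ + _); apply: eq_bigr => e eS.
  congr gmon; apply/setP => g; rewrite !inE.
  by case: (eqVneq g f) => //= ->; case: eqP => //= fe; rewrite fe eS in fS.
rewrite opprD addrACA subrr addr0 -scalerBl -scaleNr; congr (_ *: _).
have -> : m%:R = #|S|%:R + #|~: S|%:R :> F.
  by rewrite -natrD cardsC card_ord.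
by ring.
Qed.

Definition graph_module : sl2_module F :=
  triple_module D_zero_plus D_zero_minus D_plus_minus.

End GraphModule.

Section Irr.
Variables (F : fieldType) (d : nat).

(* v_k, which is 0 for k > d *)
Definition irr_vec (k : nat) : 'rV[F]_d.+1 := \row_j (j == k :> nat)%:R.

Definition irr_ext (w : 'I_d.+1 -> 'rV[F]_d.+1) : 'End('rV[F]_d.+1) :=
  linfun (fun u : 'rV[F]_d.+1 => \sum_i u 0 i *: w i).

Lemma irr_extE w u : irr_ext w u = \sum_i u 0 i *: w i.
Proof.
pose f (x : 'rV[F]_d.+1) : 'rV[F]_d.+1 := \sum_i x 0 i *: w i.
have f_lin : linear f.
  move=> c a b; rewrite /f scaler_sumr -big_split /=; apply: eq_bigr => i _.
  by rewrite !mxE scalerDl scalerA.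
pose fM := GRing.isLinear.Build F 'rV[F]_d.+1 'rV[F]_d.+1 _ f f_lin.
pose fL : {linear 'rV[F]_d.+1 -> 'rV[F]_d.+1} := HB.pack f fM.
by rewrite (lfunE fL).
Qed.

Lemma irr_ext_vec w (i : 'I_d.+1) : irr_ext w (irr_vec i) = w i.
Proof.
rewrite irr_extE (bigD1 i) //= mxE eqxx scale1r big1 ?addr0 // => j ji.
by rewrite mxE (inj_eq val_inj) (negPf ji) scale0r.
Qed.

Lemma irr_vec_unique (f g : 'End('rV[F]_d.+1)) :
  (forall i : 'I_d.+1, f (irr_vec i) = g (irr_vec i)) -> f = g.
Proof.
move=> fg; apply/lfunP => u.
have -> : u = \sum_i u 0 i *: irr_vec i.
  rewrite [LHS]row_sum_delta; apply: eq_bigr => i _; congr (_ *: _).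
  by apply/rowP => j; rewrite !mxE eqxx.
by rewrite !linear_sum; apply: eq_bigr => i _; rewrite !linearZ /= fg.
Qed.

Definition irr_plus : 'End('rV[F]_d.+1) :=
  irr_ext (fun i => (d%:R - i%:R) *: irr_vec i.+1).
Definition irr_minus : 'End('rV[F]_d.+1) :=
  irr_ext (fun i => i%:R *: irr_vec i.-1).
Definition irr_zero : 'End('rV[F]_d.+1) :=
  irr_ext (fun i => (2%:R * i%:R - d%:R) *: irr_vec i).

Lemma irr_vec0 k : (d < k)%N -> irr_vec k = 0.
Proof.
move=> dk; apply/rowP => j; rewrite !mxE; case: eqP => // jk.
by have := ltn_ord j; rewrite jk ltnS leqNgt dk.
Qed.

Lemma irr_plus_vec k : (k <= d)%N ->
  irr_plus (irr_vec k) = (d%:R - k%:R) *: irr_vec k.+1.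
Proof. by rewrite -ltnS => kd; rewrite (irr_ext_vec _ (Ordinal kd)). Qed.
Lemma irr_minus_vec k : (k <= d)%N ->
  irr_minus (irr_vec k) = k%:R *: irr_vec k.-1.
Proof. by rewrite -ltnS => kd; rewrite (irr_ext_vec _ (Ordinal kd)). Qed.
Lemma irr_zero_vec k : irr_zero (irr_vec k) = (2%:R * k%:R - d%:R) *: irr_vec k.
Proof.
have [kd|kd] := ltnP d k; first by rewrite irr_vec0 // linear0 scaler0.
by rewrite -ltnS in kd; rewrite (irr_ext_vec _ (Ordinal kd)).
Qed.

Lemma irr_zero_plus v :
  irr_zero (irr_plus v) - irr_plus (irr_zero v) = 2%:R *: irr_plus v.
Proof.
rewrite -[RHS]scale_lfunE; suff -> : 2%:R *: irr_plus =
    (irr_zero \o irr_plus)%VF - (irr_plus \o irr_zero)%VF.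
  by rewrite add_lfunE opp_lfunE !comp_lfunE.
apply: irr_vec_unique => i; have id := ltn_ord i; rewrite ltnS in id.
rewrite scale_lfunE add_lfunE opp_lfunE !comp_lfunE.
rewrite irr_zero_vec [irr_plus (_ *: _)]linearZ /= irr_plus_vec //.
rewrite [irr_zero (_ *: _)]linearZ /= irr_zero_vec.
by rewrite !scalerA -scalerBl; congr (_ *: _); rewrite -addn1 natrD; ring.
Qed.

Lemma irr_zero_minus v :
  irr_zero (irr_minus v) - irr_minus (irr_zero v) = - (2%:R *: irr_minus v).
Proof.
suff -> : irr_minus (irr_zero v) =
    (irr_zero \o irr_minus + 2%:R *: irr_minus)%VF v.
  by rewrite add_lfunE comp_lfunE scale_lfunE opprD addrA subrr add0r.
rewrite -comp_lfunE; congr (fun_of_lfun _ v).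
apply: irr_vec_unique => i; have id := ltn_ord i; rewrite ltnS in id.
rewrite add_lfunE scale_lfunE !comp_lfunE.
rewrite irr_zero_vec [irr_minus (_ *: _)]linearZ /= irr_minus_vec //.
rewrite [irr_zero (_ *: _)]linearZ /= irr_zero_vec.
rewrite !scalerA -scalerDl; congr (_ *: _).
by case: (nat_of_ord i) => [|k] /=; [|rewrite -addn1 natrD]; ring.
Qed.

Lemma irr_plus_minus v :
  irr_plus (irr_minus v) - irr_minus (irr_plus v) = irr_zero v.
Proof.
suff -> : irr_zero = (irr_plus \o irr_minus)%VF - (irr_minus \o irr_plus)%VF.
  by rewrite add_lfunE opp_lfunE !comp_lfunE.
apply: irr_vec_unique => i; have id := ltn_ord i; rewrite ltnS in id.
rewrite add_lfunE opp_lfunE !comp_lfunE irr_zero_vec.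
have -> : irr_plus (irr_minus (irr_vec i)) =
    (i%:R * (d%:R - i%:R + 1)) *: irr_vec i.
  rewrite irr_minus_vec // linearZ /=; case: (nat_of_ord i) id => [|k] kd /=.
    by rewrite mul0r !scale0r.
  rewrite irr_plus_vec 1?ltnW // scalerA; congr (_ *: _).
  by rewrite -addn1 natrD; ring.
have -> : irr_minus (irr_plus (irr_vec i)) =
    ((d%:R - i%:R) * (i%:R + 1)) *: irr_vec i.
  rewrite irr_plus_vec // linearZ /=.
  move: id; rewrite leq_eqVlt => /orP[/eqP -> | id].
    by rewrite subrr mul0r !scale0r.
  by rewrite irr_minus_vec // scalerA -natr1.
by rewrite -scalerBl; congr (_ *: _); ring.
Qed.

(* V_d *)
Definition irr_module : sl2_module F :=
  triple_module irr_zero_plus irr_zero_minus irr_plus_minus.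

End Irr.

Section DirectSum.
Variables (F : fieldType) (I : finType) (M : I -> sl2_module F).

(* As I is finite, the direct sum is the product of the M i. *)
Definition dsum_sort : Type := {dffun forall i : I, M i}.
HB.instance Definition _ := Choice.on dsum_sort.
Implicit Types u v w : dsum_sort.

Definition dsum0 : dsum_sort := [ffun i => 0].
Definition dsum_add u v : dsum_sort := [ffun i => u i + v i].
Definition dsum_opp u : dsum_sort := [ffun i => - u i].
Definition dsum_scale (a : F) u : dsum_sort := [ffun i => a *: u i].

Lemma dsum_addA : associative dsum_add.
Proof. by move=> u v w; apply/ffunP => i; rewrite !ffunE addrA. Qed.
Lemma dsum_addC : commutative dsum_add.
Proof. by move=> u v; apply/ffunP => i; rewrite !ffunE addrC. Qed.
Lemma dsum_add0 : left_id dsum0 dsum_add.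
Proof. by move=> u; apply/ffunP => i; rewrite !ffunE add0r. Qed.
Lemma dsum_addN : left_inverse dsum0 dsum_opp dsum_add.
Proof. by move=> u; apply/ffunP => i; rewrite !ffunE addNr. Qed.
HB.instance Definition _ :=
  GRing.isZmodule.Build dsum_sort dsum_addA dsum_addC dsum_add0 dsum_addN.

Lemma dsum_scaleA a b u : dsum_scale a (dsum_scale b u) = dsum_scale (a * b) u.
Proof. by apply/ffunP => i; rewrite !ffunE scalerA. Qed.
Lemma dsum_scale1 : left_id 1 dsum_scale.
Proof. by move=> u; apply/ffunP => i; rewrite !ffunE scale1r. Qed.
Lemma dsum_scaleDr : right_distributive dsum_scale +%R.
Proof. by move=> a u v; apply/ffunP => i; rewrite !ffunE scalerDr. Qed.
Lemma dsum_scaleDl u : {morph dsum_scale^~ u : a b / a + b}.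
Proof. by move=> a b; apply/ffunP => i; rewrite !ffunE scalerDl. Qed.
HB.instance Definition _ := GRing.Zmodule_isLmodule.Build F dsum_sort
  dsum_scaleA dsum_scale1 dsum_scaleDr dsum_scaleDl.

Definition dsum_act (x : sl2 F) u : dsum_sort := [ffun i => sl2_act x (u i)].

Lemma dsum_act_linearl a x y u :
  dsum_act (a *: x + y) u = a *: dsum_act x u + dsum_act y u.
Proof. by apply/ffunP => i; rewrite !ffunE sl2_act_linearl. Qed.
Lemma dsum_act_linearr x a u v :
  dsum_act x (a *: u + v) = a *: dsum_act x u + dsum_act x v.
Proof. by apply/ffunP => i; rewrite !ffunE sl2_act_linearr. Qed.
Lemma dsum_act_bracket x y u :
  dsum_act (sl2_bracket x y) u =
  dsum_act x (dsum_act y u) - dsum_act y (dsum_act x u).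
Proof. by apply/ffunP => i; rewrite !ffunE sl2_act_bracket. Qed.

Definition dsum : sl2_module F :=
  Sl2Module dsum_act_linearl dsum_act_linearr dsum_act_bracket.

End DirectSum.

Definition multiple (F : fieldType) (k : nat) (M : sl2_module F) :=
  dsum (fun _ : 'I_k => M).

(* The binomial coefficient with an integer lower index, 0 when it is negative *)
Definition binz (m : nat) (k : int) : nat := if k is Posz j then 'C(m, j) else 0.

(* Main.v *)
From HB Require Import structures.
Require Import Defs.
From mathcomp Require Import all_boot all_order all_algebra.
From mathcomp Require Import reals complex ring.

Import GRing.Theory.
Local Open Scope ring_scope.

Set Implicit Arguments.
Unset Strict Implicit.
Unset Printing Implicit Defensive.

(** Write E, G, H for the actions of e_+, e_-, h on the graph algebra A, and
    A_k for its graded parts, over any field of characteristic 0.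

    Everything rests on two facts: G E is bijective on A_k below the middle
    (2k < m), and E G is bijective on A_k above it (2k > m). Both are the same
    statement about a ladder of spaces ([ladder_inj], [ladder_surj]), read once
    upwards and once downwards. If G E a = 0 then, by the commutation relation,
    a is an eigenvector of E G with a negative integer eigenvalue; moving down
    one rung, G a is again such an eigenvector, with an even smaller
    eigenvalue, until the bottom of the ladder forces everything to vanish.

    Below the middle, G therefore maps A_(k+1) onto A_k, and rank-nullity gives
    dim P_(k+1) = C(m, k+1) - C(m, k). Above the middle G is injective, and
    this makes a primitive vector p of degree k a lowest weight vector of
    weight -(m - 2k) with E^(m - 2k + 1) p = 0: the relation
    G E^(d+1) p = (d + 1) (d - d) E^d p = 0, for d = m - 2k, takes place in
    degree m - k + 1. So p is the image of v_0 under an equivariant map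
    V_(m - 2k) -> A ([lowest_weight_map]), and letting p run through bases of
    the P_k yields an equivariant map from the direct sum to A.

    This map is onto because the P_k generate A ([primitive_generate]): up to
    the middle A_k = P_k + E A_(k-1), above it A_k = E A_(k-1). It is
    one-to-one because e_- acts nilpotently, so that a nonzero kernel would
    contain a nonzero vector killed by e_-; such a vector is a combination of
    the v_0 of the summands, and these go to linearly independent vectors. The
    same use of nilpotency shows that V_d is irreducible. *)

(** * Linearity and equivariance *)

Section Modules.
Variable F : fieldType.
Implicit Types M N : sl2_module F.

HB.instance Definition _ M (x : sl2 F) :=
  GRing.isLinear.Build F M M _ (@sl2_act F M x) (@sl2_act_linearr F M x).

Lemma sl2_actDl M (x y : sl2 F) (v : M) :
  sl2_act (x + y) v = sl2_act x v + sl2_act y v.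
Proof. by rewrite -[x]scale1r sl2_act_linearl !scale1r. Qed.

Lemma sl2_act0l M (v : M) : sl2_act 0 v = 0.
Proof. by apply: (addIr (sl2_act 0 v)); rewrite -sl2_actDl !add0r. Qed.

Lemma sl2_actZl M a (x : sl2 F) (v : M) : sl2_act (a *: x) v = a *: sl2_act x v.
Proof. by rewrite -[a *: x]addr0 sl2_act_linearl sl2_act0l addr0. Qed.

Definition equivariant M N (f : M -> N) :=
  forall x v, f (sl2_act x v) = sl2_act x (f v).

Lemma equivariant_triple M N (f : {linear M -> N}) :
    (forall v, f (sl2_act (sl2_ep F) v) = sl2_act (sl2_ep F) (f v)) ->
    (forall v, f (sl2_act (sl2_em F) v) = sl2_act (sl2_em F) (f v)) ->
    (forall v, f (sl2_act (sl2_h F) v) = sl2_act (sl2_h F) (f v)) ->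
  equivariant f.
Proof.
move=> fep fem fh x v; rewrite (sl2_span x).
by rewrite !(sl2_actDl, sl2_actZl) !linearD !linearZ /= fep fem fh.
Qed.

Lemma sl2_isomorphic_of_bij M N (f : {linear N -> M}) :
    injective f -> (forall v, exists u, f u = v) -> equivariant f ->
  sl2_isomorphic M N.
Proof.
move=> f_inj f_surj f_eq.
have f_surjb v : exists u, f u == v by case: (f_surj v) => u <-; exists u.
pose g v := xchoose (f_surjb v).
have gK : cancel g f by move=> v; apply/eqP/(xchooseP (f_surjb v)).
have fK : cancel f g by move=> u; apply: f_inj; rewrite gK.
have g_lin : linear g by exact: can2_linear fK gK.
pose gM := GRing.isLinear.Build F M N _ g g_lin.
pose gL : {linear M -> N} := HB.pack g gM.
exists gL; split; first by exists f.
by move=> x v; apply: f_inj; rewrite f_eq !gK.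
Qed.

(** Any W stable under a nilpotent g and nonzero contains a nonzero vector
    killed by g, namely the last nonzero iterate. This reduces both the
    injectivity of the decomposition map and the irreducibility of V_d to
    vectors killed by e_-. *)
Lemma nilpotent_stable_eq0 (V : zmodType) (W : V -> Prop) (g : V -> V) k v :
    (forall u, W u -> W (g u)) -> (forall u, W u -> g u = 0 -> u = 0) ->
  iter k g v = 0 -> W v -> v = 0.
Proof.
move=> Wg Wker; elim: k v => // k IHk v; rewrite iterSr => gv0 Wv.
by apply: Wker => //; apply: IHk gv0 _; apply: Wg.
Qed.

(** * Maps out of direct sums *)

Section DsumMap.
Variables (I : finType) (M : I -> sl2_module F) (N : sl2_module F).
Variable f : forall i, {linear M i -> N}.

Definition dsum_map (u : dsum M) : N := \sum_i f i ((u : dsum_sort M) i).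

Lemma dsum_map_linear : linear dsum_map.
Proof.
move=> a u v; rewrite /dsum_map scaler_sumr -big_split /=.
by apply: eq_bigr => i _; rewrite !ffunE linearP.
Qed.
HB.instance Definition _ :=
  GRing.isLinear.Build F (dsum M) N _ dsum_map dsum_map_linear.

Lemma dsum_map_equivariant :
  (forall i, equivariant (f i)) -> equivariant dsum_map.
Proof.
move=> f_eq x u; rewrite /dsum_map linear_sum /=.
by apply: eq_bigr => i _; rewrite ffunE f_eq.
Qed.

Definition dsum_inj i (v : M i) : dsum M :=
  [ffun j => dfwith (fun j : I => 0 : M j) v j].

Lemma dsum_map_inj i (v : M i) : dsum_map (dsum_inj v) = f i v.
Proof.
rewrite /dsum_map (bigD1 i) //= ffunE dfwith_in big1 ?addr0 // => j ji.
by rewrite ffunE dfwith_out 1?eq_sym // linear0.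
Qed.
End DsumMap.

Lemma iter_dsum_act (I : finType) (M : I -> sl2_module F) x k (u : dsum M) i :
  (iter k (sl2_act x) u : dsum_sort M) i
    = iter k (sl2_act x) ((u : dsum_sort M) i).
Proof. by elim: k => //= k <-; rewrite ffunE. Qed.

Lemma sl2_submodule_image M N (f : {linear M -> N}) :
  equivariant f -> sl2_submodule (fun v => exists u, f u = v).
Proof.
move=> f_eq; split.
- by exists 0; rewrite linear0.
- by move=> a _ _ [u <-] [v <-]; exists (a *: u + v); rewrite linearP.
- by move=> x _ [v <-]; exists (sl2_act x v); rewrite f_eq.
Qed.

(** * The irreducible modules *)

Section Irreducible.
Variable d : nat.
Hypothesis char0 : [pchar F] =i pred0.
Let V := irr_module F d.
Let natF_eq0 : forall n, (n%:R == 0 :> F) = (n == 0)%N := (pcharf0P F).1 char0.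

Lemma sl2_act_irr_ep (u : V) : sl2_act (sl2_ep F) u = irr_plus F d u.
Proof. exact: triple_act_ep. Qed.
Lemma sl2_act_irr_em (u : V) : sl2_act (sl2_em F) u = irr_minus F d u.
Proof. exact: triple_act_em. Qed.
Lemma sl2_act_irr_h (u : V) : sl2_act (sl2_h F) u = irr_zero F d u.
Proof. exact: triple_act_h. Qed.

Lemma irr_vec_sum (u : 'rV[F]_d.+1) : u = \sum_i u 0 i *: irr_vec F d i.
Proof.
rewrite [LHS]row_sum_delta; apply: eq_bigr => i _; congr (_ *: _).
by apply/rowP => j; rewrite !mxE eqxx.
Qed.

Lemma irr_minus_coord (u : 'rV[F]_d.+1) (i j : 'I_d.+1) :
  j = i.+1 :> nat -> irr_minus F d u 0 i = j%:R * u 0 j.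
Proof.
move=> ji; rewrite irr_extE summxE (bigD1 j) //= !mxE ji eqxx mulr1 mulrC.
rewrite big1 ?addr0 // => k kj; rewrite !mxE.
case: (posnP k) => [-> | k0]; first by rewrite mul0r mulr0.
rewrite -(inj_eq succn_inj) (prednK k0) -ji eq_sym (inj_eq val_inj) (negPf kj).
by rewrite !mulr0.
Qed.

Lemma irr_minus_coord_max (u : 'rV[F]_d.+1) : irr_minus F d u 0 ord_max = 0.
Proof.
rewrite irr_extE summxE big1 // => k _; rewrite !mxE /=.
case: (posnP k) => [-> | k0]; first by rewrite mul0r mulr0.
have := ltn_ord k; rewrite -{1}(prednK k0) ltnS => /gtn_eqF ->.
by rewrite !mulr0.
Qed.

(** Lowering shifts coordinates down by one and brings in 0 at the top. *)
Lemma iter_em_coord k (u : V) (i : 'I_d.+1) :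
  (d < i + k)%N -> (iter k (sl2_act (sl2_em F)) u : 'rV_d.+1) 0 i = 0.
Proof.
elim: k i => [|k IHk] i; first by rewrite addn0 ltnNge -ltnS ltn_ord.
rewrite iterS sl2_act_irr_em.
have [id|] := ltnP i.+1 d.+1; last first.
  rewrite ltnS => di; suff -> : i = ord_max by rewrite irr_minus_coord_max.
  by apply/val_inj/eqP; rewrite eqn_leq di -ltnS ltn_ord.
move=> dk; rewrite (@irr_minus_coord _ _ (Ordinal id)) // IHk ?mulr0 //=.
by rewrite addSnnS.
Qed.

Lemma iter_em_eq0 k (u : V) : (d < k)%N -> iter k (sl2_act (sl2_em F)) u = 0.
Proof.
move=> dk; apply/rowP => i; rewrite iter_em_coord ?mxE //.
by rewrite (leq_trans dk) ?leq_addl.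
Qed.

Lemma irr_em_ker (u : V) :
  sl2_act (sl2_em F) u = 0 -> u = (u : 'rV_d.+1) 0 0 *: irr_vec F d 0.
Proof.
rewrite sl2_act_irr_em => u0; apply/rowP => i; rewrite !mxE.
case: (posnP i) => [i0 | i0].
  have -> : i = 0 by apply/val_inj.
  by rewrite mulr1.
have id : (i.-1 < d.+1)%N by rewrite prednK // ltnW // ltn_ord.
have := @irr_minus_coord u (Ordinal id) i; rewrite /= prednK // => /(_ erefl).
rewrite u0 mxE => /esym/eqP; rewrite mulf_eq0 natF_eq0 eqn0Ngt i0 /=.
by move=> /eqP ->; rewrite mulr0.
Qed.

Theorem irr_module_irreducible : sl2_irreducible V.
Proof.
split.
  exists (irr_vec F d 0) => /rowP /(_ 0); rewrite !mxE eqxx.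
  by apply/eqP; rewrite oner_eq0.
move=> W [W0 Wlin Wact].
have Wsum (c : 'I_d.+1 -> F) (u : 'I_d.+1 -> V) :
    (forall i, W (u i)) -> W (\sum_i c i *: u i).
  by move=> Wu; elim/big_rec: _ => // i x _; apply: Wlin.
have [Wv0 | nWv0] := boolp.EM (W (irr_vec F d 0)).
  right=> v; rewrite (irr_vec_sum v); apply: (Wsum) => -[i /= id].
  rewrite ltnS in id; elim: i id => // i IHi id.
  (* e_+ v_i = (d - i) v_(i+1), and d - i is invertible as i < d. *)
  have := Wlin (d%:R - i%:R)^-1 _ _ (Wact (sl2_ep F) _ (IHi (ltnW id))) W0.
  rewrite sl2_act_irr_ep irr_plus_vec 1?ltnW // scalerA mulVf ?scale1r ?addr0 //.
  by rewrite -natrB 1?ltnW // natF_eq0 subn_eq0 -ltnNge.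
left=> v Wv; apply: (@nilpotent_stable_eq0 _ W (sl2_act (sl2_em F)) d.+1) => //.
- by move=> u; apply: Wact.
- move=> u Wu /irr_em_ker uE; rewrite uE.
  have [-> | c0] := eqVneq ((u : 'rV_d.+1) 0 0) 0; first by rewrite scale0r.
  case: nWv0; rewrite -[irr_vec F d 0](scalerK c0) -uE.
  by rewrite -[_^-1 *: u]addr0; apply: Wlin.
- exact: iter_em_eq0.
Qed.

End Irreducible.

(** * The map from V_d given by a lowest weight vector *)

Section LowestWeight.
Variables (M : sl2_module F) (d : nat) (v : M).
Hypothesis char0 : [pchar F] =i pred0.
Hypothesis em_v : sl2_act (sl2_em F) v = 0.
Hypothesis h_v : sl2_act (sl2_h F) v = - d%:R *: v.
Hypothesis ep_v : iter d.+1 (sl2_act (sl2_ep F)) v = 0.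

Let natF_eq0 : forall n, (n%:R == 0 :> F) = (n == 0)%N := (pcharf0P F).1 char0.
Let e i := iter i (sl2_act (sl2_ep F)) v.

Lemma h_iter_ep i : sl2_act (sl2_h F) (e i) = (2%:R * i%:R - d%:R) *: e i.
Proof.
elim: i => [|i IHi]; first by rewrite h_v mulr0 sub0r.
have := sl2_act_bracket (sl2_h F) (sl2_ep F) (e i).
rewrite IHi sl2_bracket_h_ep sl2_actZl linearZ /= => /eqP.
rewrite eq_sym subr_eq => /eqP ->; rewrite -scalerDl; congr (_ *: _).
by rewrite -natr1; ring.
Qed.

(** Follows by induction from e_- e_+ = e_+ e_- - h: the values
    d, d - 2, ..., d - 2i of -h on the vectors crossed by e_- sum up to
    (i + 1) (d - i). *)
Lemma em_iter_ep i :
  sl2_act (sl2_em F) (e i.+1) = (i.+1%:R * (d%:R - i%:R)) *: e i.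
Proof.
have emS j : sl2_act (sl2_em F) (e j.+1) =
    sl2_act (sl2_ep F) (sl2_act (sl2_em F) (e j)) - sl2_act (sl2_h F) (e j).
  by rewrite -sl2_bracket_ep_em sl2_act_bracket opprB addrC subrK.
elim: i => [|i IHi].
  by rewrite emS em_v linear0 h_iter_ep -scaleNr add0r; congr (_ *: _); ring.
rewrite emS IHi linearZ h_iter_ep -scalerBl /=; congr (_ *: _).
by rewrite -!natr1; ring.
Qed.

(* In V_d one has e_+^i v_0 = d (d - 1) ... (d - i + 1) v_i, so this is the
   image of v_i. For i > d it is 0, the falling factorial being 0. *)
Let w i : M := (d ^_ i)%:R^-1 *: e i.

Definition lowest_weight_map (u : irr_module F d) : M :=
  \sum_i (u : 'rV_d.+1) 0 i *: w i.

Lemma lowest_weight_map_linear : linear lowest_weight_map.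
Proof.
move=> a x y; rewrite /lowest_weight_map scaler_sumr -big_split /=.
apply: eq_bigr => i _.
have -> : (a *: x + y : 'rV_d.+1) 0 i
    = a * (x : 'rV_d.+1) 0 i + (y : 'rV_d.+1) 0 i by rewrite !mxE.
by rewrite scalerDl -scalerA.
Qed.
HB.instance Definition _ := GRing.isLinear.Build F (irr_module F d) M _
  lowest_weight_map lowest_weight_map_linear.

Lemma lowest_weight_map_vec k : lowest_weight_map (irr_vec F d k) = w k.
Proof.
have [dk | kd] := ltnP d k.
  by rewrite irr_vec0 // linear0 /w ffact_small // invr0 scale0r.
rewrite -ltnS in kd; rewrite /lowest_weight_map (bigD1 (Ordinal kd)) //= mxE.
rewrite eqxx scale1r big1 ?addr0 // => j; rewrite mxE -(inj_eq val_inj) /=.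
by move/negPf ->; rewrite scale0r.
Qed.

Lemma ep_weight i : (i <= d)%N ->
  sl2_act (sl2_ep F) (w i) = (d%:R - i%:R) *: w i.+1.
Proof.
rewrite linearZ /= -/(e i.+1) leq_eqVlt => /orP[/eqP -> | id].
  by rewrite subrr scale0r [X in _ *: X]ep_v scaler0.
have di0 : d%:R - i%:R != 0 :> F.
  by rewrite -natrB 1?ltnW // natF_eq0 subn_eq0 -ltnNge.
rewrite /w scalerA ffactnSr natrM natrB 1?ltnW // invfM mulrCA mulfV //.
by rewrite mulr1.
Qed.

Lemma em_weight i : (i <= d)%N ->
  sl2_act (sl2_em F) (w i) = i%:R *: w i.-1.
Proof.
case: i => [|i] id; first by rewrite scale0r linearZ /= em_v scaler0.
have di0 : d%:R - i%:R != 0 :> F.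
  by rewrite -natrB 1?ltnW // natF_eq0 subn_eq0 -ltnNge.
rewrite linearZ /= em_iter_ep /w !scalerA; congr (_ *: _).
rewrite ffactnSr natrM natrB 1?ltnW // invfM mulrCA; congr (_ * _).
by rewrite -mulrA mulVf // mulr1.
Qed.

Lemma h_weight i : sl2_act (sl2_h F) (w i) = (2%:R * i%:R - d%:R) *: w i.
Proof. by rewrite linearZ /= h_iter_ep /w !scalerA mulrC. Qed.

(** The operators of V_d are all given by their values g i on the basis, so
    this one computation covers e_+, e_- and h. *)
Lemma lowest_weight_map_intertwines x (g : 'I_d.+1 -> 'rV[F]_d.+1) :
    (forall i : 'I_d.+1, lowest_weight_map (g i) = sl2_act x (w i)) ->
  forall u, lowest_weight_map (irr_ext g u) = sl2_act x (lowest_weight_map u).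
Proof.
move=> fg u; rewrite irr_extE.
have -> : lowest_weight_map (\sum_i u 0 i *: g i)
    = \sum_i u 0 i *: lowest_weight_map (g i).
  by rewrite linear_sum; apply: eq_bigr => i _; exact: linearZ.
rewrite /lowest_weight_map linear_sum; apply: eq_bigr => i _.
by rewrite [RHS]linearZ /= -fg.
Qed.

Lemma lowest_weight_map_equivariant : equivariant lowest_weight_map.
Proof.
have fZ c x : lowest_weight_map (c *: x) = c *: lowest_weight_map x.
  exact: linearZ.
apply: equivariant_triple => u.
- rewrite sl2_act_irr_ep; apply: lowest_weight_map_intertwines => i.
  by rewrite fZ lowest_weight_map_vec ep_weight // -ltnS.
- rewrite sl2_act_irr_em; apply: lowest_weight_map_intertwines => i.
  by rewrite fZ lowest_weight_map_vec em_weight // -ltnS.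
- rewrite sl2_act_irr_h; apply: lowest_weight_map_intertwines => i.
  by rewrite fZ lowest_weight_map_vec h_weight.
Qed.

Lemma lowest_weight_map0 : lowest_weight_map (irr_vec F d 0) = v.
Proof. by rewrite lowest_weight_map_vec /w ffactn0 invr1 scale1r. Qed.

End LowestWeight.
End Modules.

(** * Raising and lowering along a ladder of spaces *)

Section Ladder.
Variables (F : fieldType) (V : vectType F) (X Y : 'End(V)).
Variables (W : nat -> {vspace V}) (h : nat -> nat).
Hypothesis char0 : [pchar F] =i pred0.
Hypothesis h_pos : forall n, (0 < h n.+1)%N -> (0 < h n)%N.
Hypothesis X_bottom : forall a, a \in W 0 -> X a = 0.
Hypothesis X_down : forall n a, (0 < h n)%N -> a \in W n.+1 -> X a \in W n.
Hypothesis Y_up : forall n a, a \in W n -> Y a \in W n.+1.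
Hypothesis XY : forall n a, (0 < h n)%N -> a \in W n ->
  X (Y a) = Y (X a) + (h n)%:R *: a.

Let natF_eq0 : forall n, (n%:R == 0 :> F) = (n == 0)%N := (pcharf0P F).1 char0.

(** If Y X a = - (s + 1) a, then X a, one rung lower, satisfies the same
    equation with s + 1 increased by the weight h of its rung: commuting X
    past Y can only make the eigenvalue more negative. Induction on n thus
    gives X a = 0, and then a = 0 since the eigenvalue is not 0. *)
Lemma ladder_neg_eigen_eq0 n a s : (0 < h n)%N -> a \in W n ->
  Y (X a) = - s.+1%:R *: a -> a = 0.
Proof.
move=> hn aW YXa; suff Xa0 : X a = 0.
  move/eqP: YXa; rewrite Xa0 linear0 eq_sym scaler_eq0 oppr_eq0 natF_eq0 /=.
  by move/eqP.
elim: n a s hn aW YXa => [|n IHn] a s hn aW YXa; first exact: X_bottom.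
have XaW := X_down (h_pos hn) aW.
have YXXa : Y (X (X a)) = - (h n + s).+1%:R *: X a.
  have /eqP := XY (h_pos hn) XaW.
  rewrite YXa linearZ /= -subr_eq => /eqP <-.
  by rewrite -scalerBl -addnS natrD [in RHS]opprD addrC.
have XXa0 := IHn _ _ (h_pos hn) XaW YXXa.
move/eqP: YXXa; rewrite XXa0 linear0 eq_sym scaler_eq0 oppr_eq0 natF_eq0 /=.
by move/eqP.
Qed.

Lemma ladder_inj n a : (0 < h n)%N -> a \in W n -> X (Y a) = 0 -> a = 0.
Proof.
move=> hn aW; rewrite (XY hn aW) => /eqP; rewrite addr_eq0 => /eqP YXa.
apply: (@ladder_neg_eigen_eq0 n a (h n).-1) => //.
by rewrite YXa prednK // scaleNr.
Qed.

Lemma ladder_surj n a : (0 < h n)%N -> a \in W n ->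
  exists2 b, b \in W n & a = X (Y b).
Proof.
move=> hn aW; suff : a \in ((X \o Y) @: W n)%VS.
  by case/memv_imgP => b bW ->; exists b; rewrite // comp_lfunE.
suff /eqP -> : ((X \o Y) @: W n == W n)%VS by [].
rewrite eqEdim; apply/andP; split.
  apply/subvP => _ /memv_imgP[b bW ->]; rewrite comp_lfunE.
  exact/X_down/Y_up.
rewrite limg_dim_eq //; apply/eqP; rewrite -subv0; apply/subvP => b.
rewrite memv_cap memv_ker comp_lfunE memv0 => /andP[bW /eqP XYb].
by apply/eqP/(ladder_inj hn).
Qed.
End Ladder.

(** * The grading of the graph algebra *)

Section Grading.
Variables (F : fieldType) (m : nat).
Notation A := (graded_part F m).
Notation E := (D_plus F m).
Notation G := (D_minus F m).
Notation H := (D_zero F m).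

Lemma gmon_graded (S : {set 'I_m}) : gmon F S \in A #|S|.
Proof. by apply/memv_span/imageP; exists S; rewrite ?inE. Qed.

Lemma graded_sub k (U : {vspace graph_algebra F m}) :
  (forall S : {set 'I_m}, #|S| = k -> gmon F S \in U) ->
  forall a, a \in A k -> a \in U.
Proof.
move=> kU; apply/subvP/span_subvP => _ /imageP[S + ->].
by rewrite inE => /eqP; apply: kU.
Qed.

Lemma graded_plus k a : a \in A k -> E a \in A k.+1.
Proof.
move=> aA; suff : a \in (E @^-1: A k.+1)%VS by rewrite memv_preim.
move: a aA; apply: graded_sub => S <-; rewrite -memv_preim D_plus_gmon.
apply: memv_suml => e; rewrite inE => eS.
by have := gmon_graded (e |: S); rewrite cardsU1 eS.
Qed.

Lemma graded_minus k a : a \in A k -> G a \in A k.-1.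
Proof.
move=> aA; suff : a \in (G @^-1: A k.-1)%VS by rewrite memv_preim.
move: a aA; apply: graded_sub => S <-; rewrite -memv_preim D_minus_gmon.
apply: memv_suml => e eS.
by have := gmon_graded (S :\ e); rewrite (cardsD1 e S) eS.
Qed.

Lemma graded_minus0 a : a \in A 0 -> G a = 0.
Proof.
move=> aA; apply/eqP; rewrite -memv_ker; move: a aA; apply: graded_sub => S.
by move=> /cards0_eq ->; rewrite memv_ker D_minus_gmon big_set0.
Qed.

Lemma graded_top k a : (m < k)%N -> a \in A k -> a = 0.
Proof.
move=> mk aA; apply/eqP; rewrite -memv0; move: a aA; apply: graded_sub => S Sk.
by have := max_card (mem S); rewrite card_ord Sk leqNgt mk.
Qed.

Lemma graded_zero k a : a \in A k -> H a = (2%:R * k%:R - m%:R) *: a.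
Proof.
move=> aA; apply/eqP; rewrite -subr_eq0.
suff : a \in lker (H - (2%:R * k%:R - m%:R) *: \1%VF)%VF.
  by rewrite memv_ker add_lfunE opp_lfunE scale_lfunE id_lfunE.
move: a aA; apply: graded_sub => S <-.
rewrite memv_ker add_lfunE opp_lfunE scale_lfunE id_lfunE D_zero_gmon.
by rewrite -scaleNr opprB subrr.
Qed.

Lemma dim_graded k : \dim (A k) = 'C(m, k).
Proof.
pose P := [pred T : {set 'I_m} | #|T| == k].
suff : free [seq gmon F T | T in P].
  move/eqP ->; rewrite size_image -[m in 'C(m, _)]card_ord -card_draws.
  by apply: eq_card => S; rewrite !inE.
have fr : free [seq gmon F T | T <- enum {set 'I_m}].
  have := basis_free (gbasis_basis F m); rewrite /= => fr.
  suff <- : gbasis F m = [seq gmon F T | T <- enum {set 'I_m}] :> seq _ by [].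
  apply: (@eq_from_nth _ 0); first by rewrite size_tuple size_map -cardE.
  move=> j; rewrite size_tuple => jN.
  rewrite -[j]/(val (Ordinal jN)) -tnth_nth.
  rewrite tnth_mktuple (nth_map set0) -?[size _]cardE //.
  by congr gmon; apply: enum_val_nth.
have pe : perm_eq (enum P ++ enum (predC P)) (enum {set 'I_m}).
  by rewrite [enum {set _}]enumT; exact: (permEl (perm_filterC (mem P) _)).
by rewrite -(perm_free (perm_map _ pe)) map_cat in fr; apply: catl_free fr.
Qed.

Definition graded_proj k : 'End(graph_algebra F m) :=
  gext (fun S => if #|S| == k then gmon F S else 0).

Lemma graded_projE k l a :
  a \in A l -> graded_proj k a = if l == k then a else 0.
Proof.
move=> aA; have [<- | lk] := eqVneq l k.
  apply/eqP; rewrite -subr_eq0.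
  suff : a \in lker (graded_proj l - \1%VF)%VF.
    by rewrite memv_ker add_lfunE opp_lfunE id_lfunE.
  move: a aA; apply: graded_sub => S <-.
  by rewrite memv_ker add_lfunE opp_lfunE id_lfunE gext_gmon eqxx subrr.
apply/eqP; rewrite -memv_ker; move: a aA; apply: graded_sub => S Sl.
by rewrite memv_ker gext_gmon Sl (negPf lk).
Qed.

Lemma graded_sum_eq0 n (a : 'I_n -> graph_algebra F m) :
  (forall k : 'I_n, a k \in A k) -> \sum_k a k = 0 -> forall k, a k = 0.
Proof.
move=> aA a0 k; have := congr1 (graded_proj k) a0.
rewrite linear0 linear_sum (bigD1 k) //= (graded_projE _ (aA k)) eqxx.
rewrite big1 ?addr0 // => l lk.
by rewrite (graded_projE _ (aA l)) (inj_eq val_inj) (negPf lk).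
Qed.

(** * Raising and lowering the degree *)

Section Char0.
Hypothesis char0 : [pchar F] =i pred0.

Lemma minus_plus_graded k a : (k.*2 <= m)%N -> a \in A k ->
  G (E a) = E (G a) + (m - k.*2)%:R *: a.
Proof.
move=> km aA; have := D_plus_minus a; rewrite (graded_zero aA) => /eqP.
rewrite subr_eq => /eqP ->; rewrite addrAC -scalerDl natrB // -mul2n natrM.
by rewrite addrA subrK subrr scale0r add0r.
Qed.

Let h k := (m - k.*2)%N.
Let h_gt0 k : (0 < h k)%N = (k.*2 < m)%N. Proof. exact: subn_gt0. Qed.
Let h_pos k : (0 < h k.+1)%N -> (0 < h k)%N.
Proof. by rewrite !h_gt0; apply: leq_ltn_trans; rewrite leq_double. Qed.

Lemma minus_plus_surj k a : (k.*2 < m)%N -> a \in A k ->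
  exists2 b, b \in A k & a = G (E b).
Proof.
rewrite -h_gt0; apply: (ladder_surj char0 h_pos) => {k a}.
- exact: graded_minus0.
- by move=> k a _ /graded_minus.
- by move=> k a /graded_plus.
- by move=> k a; rewrite h_gt0 => km aA; apply: minus_plus_graded => //; apply: ltnW.
Qed.

(* Above the middle, the ladder is climbed from A_m downwards, with the roles
   of E and G exchanged; the weights h are the same. *)
Let upper := fun n => A (m - n)%N.

Let upper_bottom a : a \in upper 0 -> E a = 0.
Proof. by rewrite /upper subn0 => /graded_plus/graded_top->. Qed.

Let upper_down n a : (0 < h n)%N -> a \in upper n.+1 -> E a \in upper n.
Proof.
rewrite h_gt0 => nm /graded_plus; rewrite subnSK //.
by rewrite (leq_ltn_trans _ nm) // -addnn leq_addl.
Qed.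

Let upper_up n a : a \in upper n -> G a \in upper n.+1.
Proof. by rewrite /upper subnS => /graded_minus. Qed.

Let upper_comm n a : (0 < h n)%N -> a \in upper n ->
  E (G a) = G (E a) + (h n)%:R *: a.
Proof.
rewrite h_gt0 => nm aA; have := D_plus_minus a; rewrite (graded_zero aA) => /eqP.
rewrite subr_eq => /eqP ->; rewrite addrC; congr (_ + _ *: _).
rewrite /h !natrB ?(ltnW nm) //; last first.
  by rewrite (leq_trans _ (ltnW nm)) // -addnn leq_addl.
by rewrite -addnn natrD; ring.
Qed.

Lemma plus_minus_surj k a : (m < k.*2)%N -> (k <= m)%N -> a \in A k ->
  exists2 b, b \in A k & a = E (G b).
Proof.
move=> mk km; rewrite -(subKn km).
apply: (ladder_surj char0 h_pos upper_bottom upper_down upper_up upper_comm).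
by rewrite h_gt0 doubleB ltn_subLR ?leq_double // -[m.*2]addnn ltn_add2r.
Qed.

Lemma minus_inj k a : (m < k.*2)%N -> a \in A k -> G a = 0 -> a = 0.
Proof.
move=> mk aA Ga; have [km | /graded_top] := leqP k m; last exact.
move: aA; rewrite -(subKn km) => aA.
apply: (ladder_inj char0 h_pos upper_bottom upper_down upper_comm _ aA).
  by rewrite h_gt0 doubleB ltn_subLR ?leq_double // -[m.*2]addnn ltn_add2r.
by rewrite Ga linear0.
Qed.

(** Rank-nullity for G : A_(k+1) -> A_k, which is onto below the middle. *)
Lemma dim_primitiveS k : (k.*2 < m)%N ->
  (\dim (primitive F m k.+1) + 'C(m, k) = 'C(m, k.+1))%N.
Proof.
move=> km; rewrite -!dim_graded -(limg_ker_dim G (A k.+1)); congr (_ + \dim _)%N.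
apply/eqP; rewrite eqEsubv; apply/andP; split; apply/subvP => a.
  by case/(minus_plus_surj km) => b bA ->; apply/memv_img/graded_plus.
by case/memv_imgP => b bA ->; apply: (graded_minus bA).
Qed.

Lemma dim_primitive0 : \dim (primitive F m 0) = 1%N.
Proof.
rewrite -[RHS](bin0 m) -dim_graded; congr (\dim _).
by apply/capv_idPl/subvP => a aA; rewrite memv_ker graded_minus0.
Qed.

(** * Primitive vectors *)

Let M := graph_module F m.

Lemma sl2_act_graph_ep (a : M) : sl2_act (sl2_ep F) a = E a.
Proof. exact: triple_act_ep. Qed.
Lemma sl2_act_graph_em (a : M) : sl2_act (sl2_em F) a = G a.
Proof. exact: triple_act_em. Qed.
Lemma sl2_act_graph_h (a : M) : sl2_act (sl2_h F) a = H a.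
Proof. exact: triple_act_h. Qed.

Lemma primitiveP k p : reflect (p \in A k /\ G p = 0) (p \in primitive F m k).
Proof.
rewrite memv_cap memv_ker.
by apply: (iffP andP) => -[pA Gp]; split=> //; apply/eqP.
Qed.

Lemma iter_ep_graded k i (a : M) :
  a \in A k -> iter i (sl2_act (sl2_ep F)) a \in A (k + i).
Proof.
move=> aA; elim: i => [|i IHi]; first by rewrite addn0.
by rewrite iterS sl2_act_graph_ep addnS graded_plus.
Qed.

Lemma primitive_em k (p : M) :
  p \in primitive F m k -> sl2_act (sl2_em F) p = 0.
Proof. by case/primitiveP => _ Gp; rewrite sl2_act_graph_em. Qed.

Lemma primitive_h k (p : M) : (k.*2 <= m)%N -> p \in primitive F m k ->
  sl2_act (sl2_h F) p = - (m - 2 * k)%:R *: p.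
Proof.
move=> km /primitiveP[pA _]; rewrite sl2_act_graph_h (graded_zero pA).
by rewrite natrB mul2n // opprB -mul2n natrM.
Qed.

(** With d = m - 2k, [em_iter_ep] gives G E^(d+1) p = 0, since its factor d - i
    vanishes for i = d; but E^(d+1) p has degree m - k + 1, above the middle,
    where G is injective. *)
Lemma primitive_ep_top k (p : M) : (k.*2 <= m)%N -> p \in primitive F m k ->
  iter (m - 2 * k).+1 (sl2_act (sl2_ep F)) p = 0.
Proof.
move=> km pP; have [pA _] := primitiveP _ _ pP.
have := em_iter_ep (primitive_em pP) (primitive_h km pP) (m - 2 * k).
rewrite subrr mulr0 scale0r sl2_act_graph_em.
apply: minus_inj (iter_ep_graded _ pA).
rewrite addnS doubleS ltnW // !ltnS doubleD -{1}(subnKC km) leq_add2l mul2n.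
by rewrite -[leqRHS]addnn leq_addl.
Qed.

(** By induction on the degree. Up to the middle, any a in A_(k+1) has
    G a = G E b with b in A_k, so that a - E b is primitive; beyond the middle,
    a = E (G b) already lies in E A_k. *)
Lemma primitive_generate (W : M -> Prop) :
    sl2_submodule W ->
    (forall k p, (k.*2 <= m)%N -> p \in primitive F m k -> W p) ->
  forall a, W a.
Proof.
move=> [W0 Wlin Wact] WP.
have WD u v : W u -> W v -> W (u + v).
  by move=> Wu Wv; rewrite -[u]scale1r; apply: Wlin.
have WE a : W a -> W (E a) by rewrite -sl2_act_graph_ep; apply: Wact.
have WA k a : (k <= m)%N -> a \in A k -> W a.
  elim: k a => [|k IHk] a km aA.
    by apply: (WP 0%N) => //; apply/primitiveP; rewrite graded_minus0.
  have [mk | km2] := ltnP m k.+1.*2.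
    have [b bA ->] := plus_minus_surj mk km aA.
    by apply/WE/IHk; [apply: ltnW | apply: (graded_minus bA)].
  have km' : (k.*2 < m)%N by apply: leq_trans km2; rewrite doubleS.
  have [b bA Ga] := minus_plus_surj km' (graded_minus aA).
  rewrite -(subrK (E b) a); apply: WD; last by apply/WE/IHk => //; apply: ltnW.
  apply: (WP k.+1) => //; apply/primitiveP; split.
    by rewrite rpredB // graded_plus.
  by rewrite linearB /= Ga subrr.
move=> a; rewrite -(gcoordK a) /gcomb.
elim/big_rec: _ => // S v _; apply: Wlin; apply: WA (gmon_graded S).
by rewrite -[m in leqRHS]card_ord max_card.
Qed.

(** * The decomposition *)

Lemma double_le_half (k : 'I_(m./2).+1) : (k.*2 <= m)%N.
Proof. by rewrite -geq_half_double -ltnS. Qed.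

Definition primitive_vec k (j : 'I_(\dim (primitive F m k))) : M :=
  tnth (vbasis (primitive F m k)) j.

Lemma primitive_vec_in k (j : 'I_(\dim (primitive F m k))) :
  primitive_vec j \in primitive F m k.
Proof. exact/vbasis_mem/mem_tnth. Qed.

Notation mult k := (multiple (\dim (primitive F m k)) (irr_module F (m - 2 * k)%N)).

Definition isotypic_map k : {linear mult k -> M} :=
  dsum_map (fun j => lowest_weight_map (primitive_vec j)).

Notation D := (dsum (fun k : 'I_(m./2).+1 => mult k)).

Definition decomposition_map : {linear D -> M} :=
  dsum_map (fun k : 'I_(m./2).+1 => isotypic_map k).

Lemma isotypic_map_equivariant k : (k.*2 <= m)%N -> equivariant (isotypic_map k).
Proof.
move=> km; apply: dsum_map_equivariant => j.
have pP := primitive_vec_in j.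
exact: lowest_weight_map_equivariant (primitive_em pP) (primitive_h km pP)
  (primitive_ep_top km pP).
Qed.

Lemma decomposition_map_equivariant : equivariant decomposition_map.
Proof.
apply: dsum_map_equivariant => k.
exact/isotypic_map_equivariant/double_le_half.
Qed.

Lemma decomposition_map_surj a : exists u, decomposition_map u = a.
Proof.
have [I0 Ilin Iact] := sl2_submodule_image decomposition_map_equivariant.
move: a; apply: primitive_generate => // k p km pP.
have kb : (k < (m./2).+1)%N by rewrite ltnS geq_half_double.
rewrite (coord_vbasis pP).
elim/big_rec: _ => // j x _; apply: Ilin; pose k' := Ordinal kb.
exists (dsum_inj (M := fun k : 'I_(m./2).+1 => mult k) (i := k')
  (dsum_inj (M := fun=> irr_module F (m - 2 * k')%N) (i := j)
     (irr_vec F (m - 2 * k')%N 0))).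
rewrite [LHS]dsum_map_inj [LHS]dsum_map_inj.
by rewrite [LHS]lowest_weight_map0 /primitive_vec (tnth_nth 0).
Qed.

(** Each component of a vector killed by e_- is a multiple of v_0, whose image
    is the chosen primitive vector. *)
Lemma isotypic_map_lowest k (u : mult k) :
    sl2_act (sl2_em F) u = 0 ->
  isotypic_map k u = \sum_j ((u j : 'rV_(_).+1) 0 0) *: primitive_vec j.
Proof.
move=> /ffunP em_u; apply: eq_bigr => j _.
have /(irr_em_ker char0) {1}-> : sl2_act (sl2_em F) (u j) = 0.
  by have := em_u j; rewrite !ffunE.
by rewrite linearZ; congr (_ *: _); apply: lowest_weight_map0.
Qed.

Lemma isotypic_map_lowest_inj k (u : mult k) :
  sl2_act (sl2_em F) u = 0 -> isotypic_map k u = 0 -> u = 0.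
Proof.
move=> em_u; rewrite isotypic_map_lowest // => u0.
have /freeP fr := basis_free (vbasisP (primitive F m k)).
apply/ffunP => j; rewrite ffunE.
have /(irr_em_ker char0) -> : sl2_act (sl2_em F) (u j) = 0.
  by have /ffunP/(_ j) := em_u; rewrite !ffunE.
rewrite (fr (fun j => (u j : 'rV_(_).+1) 0 0)) ?scale0r // -[RHS]u0.
by apply: eq_bigr => i _; rewrite /primitive_vec (tnth_nth 0).
Qed.

(** On vectors killed by e_-, the summand of index k goes into A_k, and the
    graded parts are independent: the summands can be treated separately. *)
Lemma decomposition_map_lowest_inj (u : D) :
  sl2_act (sl2_em F) u = 0 -> decomposition_map u = 0 -> u = 0.
Proof.
move=> /ffunP em_u u0.
have em_uk k : sl2_act (sl2_em F) (u k) = 0.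
  by have := em_u k; rewrite !ffunE.
have uA (k : 'I_(m./2).+1) : isotypic_map k (u k) \in A k.
  rewrite isotypic_map_lowest //; apply: memv_suml => j _; apply: memvZ.
  by have /primitiveP[] := primitive_vec_in j.
apply/ffunP => k; rewrite ffunE; apply: isotypic_map_lowest_inj => //.
exact: (graded_sum_eq0 uA u0).
Qed.

Lemma decomposition_map_inj : injective decomposition_map.
Proof.
apply: raddf_inj => u.
pose W v := decomposition_map v = 0.
apply: (@nilpotent_stable_eq0 _ W (sl2_act (sl2_em F)) m.+1 u).
- by move=> v; rewrite /W decomposition_map_equivariant => ->; rewrite linear0.
- by move=> v v0 em_v; apply: decomposition_map_lowest_inj.
- apply/ffunP => k; rewrite iter_dsum_act; apply/ffunP => j.
  by rewrite iter_dsum_act !ffunE iter_em_eq0 // ltnS leq_subr.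
Qed.

Theorem graph_module_decomposition : sl2_isomorphic M D.
Proof.
exact: sl2_isomorphic_of_bij decomposition_map_inj decomposition_map_surj
  decomposition_map_equivariant.
Qed.
End Char0.
End Grading.

Unset Implicit Arguments.

Theorem theorem3p4 (R : realType) (n : nat) :
  let m := 'C(n, 2) in
  let mu (k : nat) : nat := \dim (primitive R[i] m k) in
  [/\ sl2_isomorphic (graph_module R[i] m)
        (dsum (fun k : 'I_(m./2).+1 =>
           multiple (mu k) (irr_module R[i] (m - 2 * k)%N))),
      forall k : nat, (k <= m./2)%N ->
        sl2_irreducible (irr_module R[i] (m - 2 * k)%N)
    & forall k : nat, (k <= m./2)%N ->
        (mu k)%:Z = (binz m k%:Z)%:Z - (binz m (k%:Z - 1))%:Z].
Proof.
move=> m mu; have char0 : [pchar R[i]] =i pred0 := Num.Theory.pchar_num _.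
split=> [|k _|[|k] km].
- exact: graph_module_decomposition.
- exact: irr_module_irreducible.
- by rewrite /mu dim_primitive0 //= bin0 subr0.
rewrite geq_half_double doubleS in km.
have -> : k.+1%:Z - 1 = k%:Z by rewrite intS addrAC subrr add0r.
by rewrite /= -(dim_primitiveS char0 (ltnW km)) PoszD addrK.
Qed.
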